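(* For every integer $n\ge 5$, the boxicity of the Kneser graph $\mathrm{KG}(n,2)$ equals $n-2$. In particular, the boxicity of the Petersen graph $\mathrm{KG}(5,2)$ is $3$.
   Context: For integers $n\ge 2k+1$, the Kneser graph $\mathrm{KG}(n,k)$ has as vertices the $k$-element subsets of $\{1,\dots,n\}$, two vertices being adjacent iff the corresponding sets are disjoint. The boxicity $\mathrm{box}(G)$ of a graph $G$ is the minimum $d\ge 0$ such that $G$ is the intersection graph of a family of axis-parallel boxes $I_1\times\cdots\times I_d$ in $\mathbb{R}^d$ (each $I_j$ a closed real interval), one box per vertex, two distinct vertices adjacent iff their boxes intersect; complete graphs have boxicity $0$. *)

(* Defs.v *)
From HB Require Import structures.
From mathcomp Require Import all_boot all_order all_algebra.
From mathcomp Require Import boolp classical_sets reals.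

Set Implicit Arguments.
Unset Strict Implicit.
Unset Printing Implicit Defensive.

Import Order.TTheory GRing.Theory Num.Theory.
Local Open Scope ring_scope.
Local Open Scope classical_set_scope.

Record sgraph := SGraph {
  vertex :> finType;
  adj : rel vertex;
  adj_sym : symmetric adj;
  adj_irr : irreflexive adj }.

Definition ksubset (n k : nat) := {A : {set 'I_n} | #|A| == k}.

(* The condition [A != B] only matters for k = 0, where it removes the loop at
   the empty set. *)
Definition kneser_adj (n k : nat) : rel (ksubset n k) :=
  fun A B => (A != B) && [disjoint val A & val B].

Lemma kneser_adj_sym (n k : nat) : symmetric (@kneser_adj n k).
Proof. by move=> A B; rewrite /kneser_adj /= eq_sym disjoint_sym. Qed.

Lemma kneser_adj_irr (n k : nat) : irreflexive (@kneser_adj n k).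
Proof. by move=> A; rewrite /kneser_adj /= eqxx. Qed.

Definition kneser (n k : nat) : sgraph :=
  SGraph (@kneser_adj_sym n k) (@kneser_adj_irr n k).

Definition box (R : realType) (d : nat) (a b : 'rV[R]_d) : set 'rV[R]_d :=
  [set x : 'rV[R]_d | forall j, a 0 j <= x 0 j <= b 0 j].

(* For d = 0 every box is the one-point space R^0, so any two boxes meet: the
   graphs representable in dimension 0 are exactly the complete graphs. *)
Definition box_representable (R : realType) (G : sgraph) (d : nat) : Prop :=
  exists a b : G -> 'rV[R]_d,
    (forall v j, a v 0 j <= b v 0 j) /\
    (forall u v : G, u != v ->
       adj u v <-> box (a u) (b u) `&` box (a v) (b v) !=set0).

(* One coordinate per ordered pair (p, q) of vertices: if p and q are distinct
   and nonadjacent, p gets [0, 0], q gets [1, 1] and every other vertex gets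
   [0, 1]; otherwise every vertex gets [0, 1]. *)
Lemma box_representable_ex (R : realType) (G : sgraph) :
  exists d, `[< box_representable R G d >].
Proof.
exists #|{: G * G}|; apply/asboolP.
pose bad (w : G * G) := (w.1 != w.2) && ~~ adj w.1 w.2.
pose P j : G * G := @enum_val (G * G)%type predT j.
exists (fun v => \row_j (bad (P j) && (v == (P j).2))%:R).
exists (fun v => \row_j (~~ (bad (P j) && (v == (P j).1)))%:R).
split=> [v j|u v uv].
  rewrite !mxE ler_nat; case: (boolP (bad (P j))) => //= /andP[pq _].
  by case: eqP => //= ->; rewrite eq_sym pq.
split=> [e|[x [xu xv]]].
  exists (\row_j ((bad (P j)) && ((u == (P j).2) || (v == (P j).2)))%:R).
  split=> j; rewrite !mxE !ler_nat;
    case: (boolP (bad (P j))) => //= /andP[pq npq].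
    case: (eqVneq u (P j).2) => [->|_] /=; first by rewrite eq_sym pq.
    case: (eqVneq u (P j).1) => [up|_] /=; last by case: (_ == _).
    by case: eqP => //= vq; move: npq; rewrite -up -vq e.
  case: (eqVneq v (P j).2) => [->|_] /=.
    by rewrite orbT [_ == (P j).1]eq_sym pq.
  rewrite orbF; case: (eqVneq v (P j).1) => [vp|_] /=; last by case: (_ == _).
  by case: eqP => //= uq; move: npq; rewrite -vp -uq adj_sym e.
apply/negPn/negP => ne.
have bw : bad (u, v) by rewrite /bad /= uv.
have Pj : P (enum_rank (u, v)) = (u, v) by rewrite /P enum_rankK.
have := xu (enum_rank (u, v)); have := xv (enum_rank (u, v)).
rewrite !mxE Pj bw /= !eqxx /= => /andP[h1 _] /andP[_ h0].
by have := le_trans h1 h0; rewrite ler10.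
Qed.

Definition boxicity (R : realType) (G : sgraph) : nat :=
  ex_minn (box_representable_ex R G).

(* Main.v *)
Require Import Defs.
From mathcomp Require Import all_boot all_order all_algebra zify.
From mathcomp Require Import boolp reals.

Set Implicit Arguments.
Unset Strict Implicit.
Unset Printing Implicit Defensive.

Import Order.TTheory GRing.Theory Num.Theory.

(** Vertices of KG(n,2) are edges of K_n, and its non-edges are the cherries
    {xa, xb}. A coordinate of a box representation is an interval order on the
    edges of K_n in which disjoint edges are incomparable, and every cherry must
    be separated by some coordinate.

    Upper bound: for each vertex v other than two fixed ones, order the edges at
    v as points, with the fixed vertices at the two ends.

    Lower bound: suppose that n - 3 coordinates suffice. Cover the cherries
    centred at x that a coordinate separates by stars {xa, x*}, of weight 2, and
    single cherries, of weight 1. As all pairs of neighbours of x must be covered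
    and C(t,2) >= 2t - 3, the weights at x add up to at least 2n - 5 over all
    coordinates. Comparing with the first edge cp and the last edge cq of the
    order shows that a coordinate has weight at most 6 outside a centre c, unless
    it is an exceptional one of total weight at most 13. At least three vertices,
    plus one for each exceptional coordinate, are not centres; summing over them
    gives a contradiction for n >= 6. For n = 5 the exceptional coordinates need
    a finer description. *)

(** * Edge orders, separated cherries and their weights *)

Section EdgeOrders.

Variable V : finType.
Implicit Types (P : V -> V -> V -> V -> bool) (x a b c p q u w : V).

(* [P a b x y] reads: the edge ab lies before the edge xy. *)
Record edge_order P : Prop := EdgeOrder {
  eo_neq a b x y : P a b x y -> a <> b /\ x <> y;
  eo_symL a b x y : P a b x y = P b a x y;
  eo_symR a b x y : P a b x y = P a b y x;
  eo_irr a b : P a b a b = false;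
  eo_free a b x y a' b' x' y' :
    P a b x y -> P a' b' x' y' -> P a b x' y' \/ P a' b' x y;
  eo_meet a b x y : P a b x y -> a = x \/ a = y \/ b = x \/ b = y }.

Definition converse P a b x y := P x y a b.

Lemma converse_edge_order P : edge_order P -> edge_order (converse P).
Proof.
case=> neq symL symR irr free meet; split; rewrite /converse.
- by move=> a b x y /neq[].
- by move=> a b x y; rewrite symR.
- by move=> a b x y; rewrite symL.
- exact: irr.
- by move=> a b x y a' b' x' y' h h'; case: (free _ _ _ _ _ _ _ _ h h'); auto.
- by move=> a b x y /meet; intuition.
Qed.

Definition separated P x a b := P x a x b || P x b x a.

Lemma separated_converse P : separated (converse P) = separated P.
Proof.
by apply/funext => x; apply/funext => a; apply/funext => b; rewrite /separated orbC.
Qed.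

(** Here [s] is separation at one fixed centre: [S] records the stars, [E] the single cherries. *)
Definition weight_cover (s : V -> V -> bool) (k : nat) :=
  exists (S : {set V}) (E : {set {set V}}), 2 * #|S| + #|E| <= k /\
    forall a b, s a b -> [\/ a \in S, b \in S | [set a; b] \in E].

Definition centered (om : V -> nat) k := exists c, \sum_(x | x != c) om x <= k.

(** The exceptional coordinates. The vertex of weight 0 and the final alternative serve the case of
    five vertices, where two exceptional coordinates may occur together. *)
Definition light (om : V -> nat) :=
  [/\ \sum_x om x <= 13, exists u, om u = 0 &
      centered om 7 \/ forall x, om x <= 4].

Definition classified (s : V -> V -> V -> bool) :=
  exists om, (forall x, weight_cover (s x) (om x)) /\ (centered om 6 \/ light om).

(** Explicit covers for all centres at once: [(x, a)] in [ss] is the star {xa, x*}, and [(x, a, b)]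
    in [es] is the cherry {xa, xb}. *)
Definition list_weight (ss : seq (V * V)) (es : seq (V * V * V)) x :=
  2 * count (fun i => i.1 == x) ss + count (fun i => i.1.1 == x) es.

Definition list_covers (ss : seq (V * V)) (es : seq (V * V * V)) x a b :=
  [|| (x, a) \in ss, (x, b) \in ss, (x, a, b) \in es | (x, b, a) \in es].

Lemma card_set_seq (T : finType) (A : {set T}) (s : seq T) :
  (forall y : T, y \in A -> y \in s) -> #|A| <= size s.
Proof.
by move=> h; apply: leq_trans (card_size s); apply: subset_leq_card; apply/subsetP.
Qed.

Lemma list_weight_cover (s : V -> V -> bool) ss es x :
  (forall a b, s a b -> list_covers ss es x a b) ->
  weight_cover s (list_weight ss es x).
Proof.
move=> h.
pose s1 := [seq i.2 | i <- ss & i.1 == x].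
pose s2 := [seq [set i.1.2; i.2] | i <- es & i.1.1 == x].
exists [set a in s1], [set A in s2]; split.
  rewrite /list_weight; apply: leq_add; rewrite ?leq_mul2l /= -size_filter.
    by rewrite -(size_map snd) card_set_seq // => y; rewrite inE.
  rewrite -(size_map (fun i => [set i.1.2; i.2])) card_set_seq // => y.
  by rewrite inE.
move=> a b /h /or4P[] m; [apply: Or31 | apply: Or32 | apply: Or33 | apply: Or33];
  rewrite inE; apply/mapP.
- by exists (x, a) => //; rewrite mem_filter eqxx.
- by exists (x, b) => //; rewrite mem_filter eqxx.
- by exists (x, a, b) => //; rewrite mem_filter eqxx.
- by exists (x, b, a); rewrite ?mem_filter ?eqxx //= setUC.
Qed.

Lemma sum_count (T : Type) (Q : pred V) (f : T -> V) (s : seq T) :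
  \sum_(x | Q x) count (fun i => f i == x) s = count (fun i => Q (f i)) s.
Proof.
elim: s => [|i s IH] /=; first by rewrite big1.
rewrite big_split /= IH; congr (_ + _).
case: (boolP (Q (f i))) => Qi.
  rewrite (bigD1 (f i)) //= eqxx big1 ?addn0 // => y /andP[_ /negPf].
  by rewrite eq_sym => ->.
rewrite big1 // => y Qy; case: eqP => // e; by rewrite e Qy in Qi.
Qed.

Lemma sum_list_weight (Q : pred V) ss es :
  \sum_(x | Q x) list_weight ss es x =
  2 * count (fun i => Q i.1) ss + count (fun i => Q i.1.1) es.
Proof. by rewrite big_split /= -big_distrr /= !sum_count. Qed.

Lemma weight_cover_full (s : V -> V -> bool) : weight_cover s (2 * #|V|).
Proof.
exists setT, set0; rewrite cardsT cards0 addn0; split=> // a b _.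
by apply: Or31; rewrite inE.
Qed.

Lemma classified_centered (s : V -> V -> V -> bool) c ss es :
  2 * size ss + size es <= 6 ->
  (forall x a b, x <> c -> s x a b -> list_covers ss es x a b) ->
  classified s.
Proof.
(* The centre can afford the trivial cover by all stars, since its weight is left out of the sum. *)
move=> hs h; exists (fun x => if x == c then 2 * #|V| else list_weight ss es x).
split=> [x|].
  case: eqP => [_|xc]; first exact: weight_cover_full.
  by apply: list_weight_cover => a b; apply: h.
left; exists c; rewrite (eq_bigr (list_weight ss es)) => [|x /negPf -> //].
by rewrite sum_list_weight; apply: leq_trans hs; rewrite leq_add ?leq_mul ?count_size.
Qed.

Lemma classified_light (s : V -> V -> V -> bool) ss es :
  (forall x a b, s x a b -> list_covers ss es x a b) ->
  light (list_weight ss es) -> classified s.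
Proof.
move=> h l; exists (list_weight ss es); split; last by right.
by move=> x; apply: list_weight_cover => a b; apply: h.
Qed.

Lemma exists_outside4 c p q w : 5 <= #|V| -> exists u, [/\ u <> c, u <> p, u <> q & u <> w].
Proof.
move=> V5; have : 0 < #|~: [set y in [:: c; p; q; w]]|.
  have := cardsC [set y in [:: c; p; q; w]].
  have : #|[set y in [:: c; p; q; w]]| <= 4.
    by apply: (@card_set_seq _ _ [:: c; p; q; w]) => y; rewrite inE.
  by lia.
case/card_gt0P => u; rewrite !inE => /norP[/eqP ? /norP[/eqP ? /norP[/eqP ? /eqP ?]]].
by exists u.
Qed.

End EdgeOrders.

(** * Orders framed by a first edge cp and a last edge cq *)

Section Frame.

Variable V : finType.
Implicit Types (P : V -> V -> V -> V -> bool) (x a b c p q u w : V).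

Record framed P c p q : Prop := Framed {
  fr_order : edge_order P;
  fr_first a b x y : P a b x y -> P c p x y;
  fr_last a b x y : P a b x y -> P a b c q;
  fr_cpq : P c p c q }.

(** Reversal swaps p and q, hence also the patterns A with B and D with E, while C is preserved. *)
Lemma framed_converse P c p q : framed P c p q -> framed (converse P) c q p.
Proof.
case=> o f l h; split=> //; first exact: converse_edge_order.
- by move=> a b x y /l.
- by move=> a b x y /f.
Qed.

Lemma framed_neq P c p q : framed P c p q -> [/\ c <> p, c <> q & p <> q].
Proof.
move=> F; have o := fr_order F; have h := fr_cpq F.
have [cp cq] := eo_neq o h; split=> // pq.
by rewrite pq (eo_irr o) in h.
Qed.

(** Runs through the possible common vertices of two comparable edges and discards those excluded by
    known inequalities. *)
Ltac split_meet H := let n := fresh "nq" in let n' := fresh "nq" in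
  match type of H with is_true (?P _ _ _ _) =>
    match goal with o : edge_order P |- _ =>
      have [n n'] := eo_neq o H;
      destruct (eo_meet o H) as [?|[?|[?|?]]]; subst; try congruence
    end end.

(* The last five disjuncts are the patterns D: pq < pb, E: qa < qp, A: xc < xp,
   B: xq < xc and C: xq < xp. *)
Lemma framed_off_center P c p q x a b : framed P c p q -> x <> c -> P x a x b ->
  (x = p /\ a = c) \/ (x = q /\ b = c) \/ (x = p /\ a = q) \/ (x = q /\ b = p) \/
  (a = c /\ b = p) \/ (a = q /\ b = c) \/ (a = q /\ b = p).
Proof.
move=> F xc h; have o := fr_order F; have [cp cq pq] := framed_neq F.
have ab : a <> b by move=> e; rewrite e (eo_irr o) in h.
(* Now cp lies before xb, and xa before cq. Both pairs must meet, and combining the ways they can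
   meet off c leaves the seven cases. *)
have h1 := fr_first F h; have h2 := fr_last F h.
have [? ?] := eo_neq o h; have m1 := eo_meet o h1; have m2 := eo_meet o h2.
by intuition congruence.
Qed.

Section Patterns.

Variables (P : V -> V -> V -> V -> bool) (c p q : V).
Hypothesis F : framed P c p q.

Let o : edge_order P := fr_order F.
Let symL := eo_symL o.
Let symR := eo_symR o.
Let irr := eo_irr o.

Lemma patA_out w : P w c w p -> [/\ w <> c, w <> p & w <> q].
Proof.
move=> h; have [? ?] := eo_neq o h; split=> // e; subst.
by have := fr_last F h; rewrite symL irr.
Qed.

Lemma patC_out w : P w q w p -> [/\ w <> c, w <> p & w <> q].
Proof.
move=> h; have [? ?] := eo_neq o h; split=> // e; subst.
by have := fr_first F h; rewrite irr.
Qed.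

Lemma patD_out u : P p q p u -> [/\ u <> c, u <> p & u <> q].
Proof.
move=> h; have [? ?] := eo_neq o h; split=> [e||e]; try congruence; subst.
by have := fr_first F h; rewrite symL irr.
Qed.

(** Covering is symmetric in the two ends of a cherry, so one orientation suffices. *)
Lemma separated_covers Q ss es :
  (forall x a b, Q x -> P x a x b -> list_covers ss es x a b) ->
  forall x a b, Q x -> separated P x a b -> list_covers ss es x a b.
Proof.
move=> h x a b Qx /orP[] /(h _ _ _ Qx) //.
rewrite /list_covers => /or4P[] ->; by rewrite ?orbT.
Qed.

(** For distinct w and w', [eo_free] would compare wc with w'p or w'c with wp, which are disjoint
    pairs. The next two lemmas follow the same scheme. *)
Lemma patA_uniq w w' : P w c w p -> P w' c w' p -> w = w'.
Proof.
move=> h h'; have [? ? ?] := patA_out h; have [? ? ?] := patA_out h'.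
by case: (eqVneq w w') => // /eqP ?; case: (eo_free o h h') => k; split_meet k.
Qed.

Lemma patC_uniq w w' : P w q w p -> P w' q w' p -> w = w'.
Proof.
move=> h h'; have [? ? ?] := patC_out h; have [? ? ?] := patC_out h'.
have [_ _ ?] := framed_neq F.
by case: (eqVneq w w') => // /eqP ?; case: (eo_free o h h') => k; split_meet k.
Qed.

Lemma patAC_uniq w w' : P w c w p -> P w' q w' p -> w = w'.
Proof.
move=> h h'; have [? ? ?] := patA_out h; have [? ? ?] := patC_out h'.
have [? ? ?] := framed_neq F.
by case: (eqVneq w w') => // /eqP ?; case: (eo_free o h h') => k; split_meet k.
Qed.

(** If u differs from w, [eo_free] offers wq before pu, which are disjoint, or the claim. *)
Lemma patCD w u : P w q w p -> P p q p u -> P p q p w.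
Proof.
move=> h h'; have [? ? ?] := patC_out h; have [? ? ?] := patD_out h'.
have [? ? ?] := framed_neq F.
case: (eqVneq u w) => [<- //|/eqP ?].
case: (eo_free o h h') => k; first by split_meet k.
by rewrite symR.
Qed.

(** Here [eo_free] gives wq before pu, since pq and wc are disjoint; these edges meet only if u =
    w. *)
Lemma patBD w u : P w q w c -> P p q p u -> u = w /\ P w q w p.
Proof.
move=> h h'; have [? ? ?] := patD_out h'.
have [? ? ?] := framed_neq F; have [? ?] := eo_neq o h.
have wp : w <> p by move=> e; subst; have := fr_first F h; rewrite symL irr.
case: (eo_free o h h') => k; last by split_meet k.
have uw : u = w by split_meet k.
by split=> //; subst; rewrite symR.
Qed.

(** Here [eo_free] gives qv before pu, since pq is not before itself; these edges meet only if u =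
    v. *)
Lemma patDE u v : P p q p u -> P q v q p -> u = v /\ P u q u p.
Proof.
move=> h h'; have [? ? ?] := patD_out h.
have [? ? ?] := framed_neq F; have [? ?] := eo_neq o h'.
have vp : v <> p by move=> e; subst; rewrite irr in h'.
case: (eo_free o h h') => k; first by move: k; rewrite symL irr.
have uv : u = v by split_meet k.
by split=> //; subst; rewrite symR symL.
Qed.

End Patterns.

(** * Classification of framed orders by the patterns that occur *)

Ltac listed := subst; rewrite /list_covers !inE !xpair_eqE !eqxx /= ?orbT; done.

Lemma leq_eq_sum x a b : a <> b -> (a == x) + (b == x) <= 1.
Proof. by move=> ab; case: eqP => [<-|_]; [rewrite eq_sym (introF eqP ab) | case: (_ == _)]. Qed.

(** All listed centres lie among four vertices, so a fifth vertex has weight 0. *)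
Lemma light_weights ss es c p q w :
  5 <= #|V| -> 2 * size ss + size es <= 13 ->
  (forall i, i \in map fst ss -> i \in [:: c; p; q; w]) ->
  (forall i, i \in map (fun e => e.1.1) es -> i \in [:: c; p; q; w]) ->
  centered (list_weight ss es) 7 \/ (forall x, list_weight ss es x <= 4) ->
  light (list_weight ss es).
Proof.
move=> V5 hs h1 h2 h3; split=> //.
  apply: leq_trans hs; rewrite sum_list_weight.
  by rewrite leq_add ?leq_mul ?count_size.
have [u [? ? ? ?]] := exists_outside4 c p q w V5.
have un : u \notin [:: c; p; q; w].
  by rewrite !inE; do 3 (apply/norP; split; first exact/eqP); exact/eqP.
exists u.
have u1 : count_mem u (map fst ss) = 0 by apply/count_memPn; apply: contra un => /h1.
have u2 : count_mem u (map (fun e => e.1.1) es) = 0.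
  by apply/count_memPn; apply: contra un => /h2.
by rewrite /list_weight; move: u1 u2; rewrite !count_map /= => -> ->.
Qed.

(** By [patBD] and [patDE], patterns B and E would each force u = u', so neither occurs. The cover
    has total weight 12: at most 4 at c and p, 2 at q and w. *)
Lemma classified_double_D P c p q u u' : 5 <= #|V| -> framed P c p q ->
  P p q p u -> P p q p u' -> u <> u' -> classified (separated P).
Proof.
move=> V5 F hu hu' uu'; have o := fr_order F.
have [cp cq pq] := framed_neq F.
have [uc up uq] := patD_out F hu; have [uc' up' uq'] := patD_out F hu'.
(* Patterns A and C occur at no more than one vertex between them; if there is none, u is a
   placeholder. *)
have [w [wc wp wq hw]] : exists w, [/\ w <> c, w <> p, w <> q &
    forall x, P x c x p \/ P x q x p -> x = w].
  case: (pselect (exists w, P w q w p)) => [[w h]|nC].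
    have [? ? ?] := patC_out F h; exists w; split=> // x [] h'.
      exact: (patAC_uniq F h' h).
    exact: (patC_uniq F h' h).
  case: (pselect (exists w, P w c w p)) => [[w h]|nA].
    have [? ? ?] := patA_out F h; exists w; split=> // x [] h'.
      exact: (patA_uniq F h' h).
    by case: nC; exists x.
  by exists u; split=> // x [] h; [case: nA | case: nC]; exists x.
apply: (@classified_light _ _ [:: (c, p); (p, c); (c, q); (q, c); (p, q)]
  [:: (w, c, p); (w, p, q)]).
  move=> x a b; apply: (separated_covers (Q := fun=> True)) => // {}x {}a {}b _ h.
  case: (eqVneq x c) => [e|/eqP xc].
    subst x; have [? ?] := eo_neq o h.
    case: (eqVneq a p) => [?|/eqP ?]; first by listed.
    case: (eqVneq b p) => [?|/eqP ?]; first by listed.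
    case: (eqVneq a q) => [?|/eqP ?]; first by listed.
    case: (eqVneq b q) => [?|/eqP ?]; first by listed.
    (* A cherry ca, cb avoiding p and q contradicts whichever of the two D patterns has its end
       different from a. *)
    exfalso; case: (eqVneq a u) => [?|/eqP ?].
      by case: (eo_free o h hu') => k; split_meet k.
    by case: (eo_free o h hu) => k; split_meet k.
  have := framed_off_center F xc h.
  case=> [[? ?]|[[? ?]|[[? ?]|[[? ?]|[[? ?]|[[? ?]|[? ?]]]]]]]; subst; try by listed.
  - have [? _] := patDE F hu h; have [? _] := patDE F hu' h; congruence.
  - by have := hw _ (or_introl h) => ?; listed.
  - have [? _] := patBD F h hu; have [? _] := patBD F h hu'; congruence.
  - by have := hw _ (or_intror h) => ?; listed.
apply: (@light_weights _ _ c p q w) => //=.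
- by move=> i; rewrite !inE; do ![case: (i == _) => //=].
- by move=> i; rewrite !inE; do ![case: (i == _) => //=].
right=> x; rewrite /list_weight /=.
have := leq_eq_sum x cp; have := leq_eq_sum x cq; have := leq_eq_sum x pq.
have := leq_eq_sum x wc; have := leq_eq_sum x wp; have := leq_eq_sum x wq.
by move: (c == x) (p == x) (q == x) (w == x); lia.
Qed.

(** The relation cw before cy excludes the patterns B and E, which pays for the third star cw at c:
    the total is 13, of which 7 lies off c. *)
Lemma classified_C_skew P c p q w y : 5 <= #|V| -> framed P c p q ->
  P w q w p -> (forall u, P p q p u -> u = w) -> (forall u, P q u q p -> u = w) ->
  P c w c y -> y <> q -> classified (separated P).
Proof.
move=> V5 F hC hD hE hy yq; have o := fr_order F.
have [cp cq pq] := framed_neq F; have [wc wp wq] := patC_out F hC.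
have [_ cy] := eo_neq o hy.
have wy : w <> y by move=> e; rewrite e (eo_irr o) in hy.
have Fc := framed_converse F.
apply: (@classified_light _ _ [:: (c, p); (c, q); (c, w); (p, c); (q, c)]
  [:: (w, c, p); (w, p, q); (p, q, w)]).
  move=> x a b; apply: (separated_covers (Q := fun=> True)) => // {}x {}a {}b _ h.
  have [? ?] := eo_neq o h.
  case: (eqVneq x c) => [e|/eqP xc].
    subst x.
    case: (eqVneq a p) => [?|/eqP ?]; first by listed.
    case: (eqVneq b p) => [?|/eqP ?]; first by listed.
    case: (eqVneq a q) => [?|/eqP ?]; first by listed.
    case: (eqVneq b q) => [?|/eqP ?]; first by listed.
    case: (eqVneq a w) => [?|/eqP ?]; first by listed.
    case: (eqVneq b w) => [?|/eqP ?]; first by listed.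
    by exfalso; case: (eo_free o h hC) => k; split_meet k.
  have := framed_off_center F xc h.
  case=> [[? ?]|[[? ?]|[[? ?]|[[? ?]|[[? ?]|[[? ?]|[? ?]]]]]]]; subst; try by listed.
  - by have := hD _ h => ?; listed.
  - have aw := hE _ h; subst a.
    by exfalso; case: (eo_free o h hy) => k; split_meet k.
  - by have ? := patAC_uniq F h hC; listed.
  - have ? : x = w by exact: (patAC_uniq Fc h hC).
    subst x; exfalso; case: (eo_free o h hy) => k; first by split_meet k.
    by move: k; rewrite (eo_symL o) (eo_irr o).
  - by have ? := patC_uniq F h hC; listed.
apply: (@light_weights _ _ c p q w) => //=.
- by move=> i; rewrite !inE; do ![case: (i == _) => //=].
- by move=> i; rewrite !inE; do ![case: (i == _) => //=].
left; exists c; rewrite sum_list_weight /= !eqxx /=.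
by move: (p != c) (q != c) (w != c); lia.
Qed.

Lemma classified_C P c p q w : 5 <= #|V| -> framed P c p q ->
  P w q w p -> (forall u, P p q p u -> u = w) -> (forall u, P q u q p -> u = w) ->
  classified (separated P).
Proof.
move=> V5 F hC hD hE; have o := fr_order F.
have [cp cq pq] := framed_neq F; have [wc wp wq] := patC_out F hC.
have Fc := framed_converse F.
(* A cherry at c avoiding p and q must contain cw, by comparison with pattern C; it is then skew for
   the order or its converse. Without such cherries, two stars at c suffice. *)
case: (pselect (exists a b, [/\ P c a c b, a <> p, a <> q, b <> p & b <> q])).
  case=> a [b [h ap aq bp bq]]; have [? ?] := eo_neq o h.
  case: (eqVneq a w) => [?|/eqP ?]; first by subst; apply: classified_C_skew hC hD hE h bq.
  case: (eqVneq b w) => [?|/eqP ?].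
    subst; rewrite -separated_converse.
    by apply: (classified_C_skew V5 Fc (w := w) (y := a)); rewrite /converse.
  by exfalso; case: (eo_free o h hC) => k; split_meet k.
move=> hc.
apply: (@classified_light _ _ [:: (c, p); (p, c); (c, q); (q, c)]
  [:: (w, c, p); (w, c, q); (w, p, q); (p, q, w); (q, p, w)]).
  move=> x a b; apply: (separated_covers (Q := fun=> True)) => // {}x {}a {}b _ h.
  case: (eqVneq x c) => [e|/eqP xc].
    subst x.
    case: (eqVneq a p) => [?|/eqP ?]; first by listed.
    case: (eqVneq b p) => [?|/eqP ?]; first by listed.
    case: (eqVneq a q) => [?|/eqP ?]; first by listed.
    case: (eqVneq b q) => [?|/eqP ?]; first by listed.
    by case: hc; exists a, b.
  have := framed_off_center F xc h.
  case=> [[? ?]|[[? ?]|[[? ?]|[[? ?]|[[? ?]|[[? ?]|[? ?]]]]]]]; subst; try by listed.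
  - by have := hD _ h => ?; listed.
  - by have := hE _ h => ?; listed.
  - by have ? := patAC_uniq F h hC; listed.
  - by have ? : x = w by [exact: (patAC_uniq Fc h hC)]; listed.
  - by have ? := patC_uniq F h hC; listed.
apply: (@light_weights _ _ c p q w) => //=.
- by move=> i; rewrite !inE; do ![case: (i == _) => //=].
- by move=> i; rewrite !inE; do ![case: (i == _) => //=].
right=> x; rewrite /list_weight /=.
have := leq_eq_sum x cp; have := leq_eq_sum x cq; have := leq_eq_sum x pq.
have := leq_eq_sum x wc; have := leq_eq_sum x wp; have := leq_eq_sum x wq.
by move: (c == x) (p == x) (q == x) (w == x); lia.
Qed.

(** Alongside D, a pattern B or E would produce a C. What remains off c is two stars and the single
    cherries of A and D, of weight 6. *)
Lemma classified_D_noC P c p q u : framed P c p q ->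
  (forall w, ~ P w q w p) -> P p q p u -> (forall v, P p q p v -> v = u) ->
  classified (separated P).
Proof.
move=> F hC hu hD.
have [w hw] : exists w, forall x, P x c x p -> x = w.
  case: (pselect (exists w, P w c w p)) => [[w h]|nA].
    by exists w => x h'; exact: (patA_uniq F h' h).
  by exists c => x h; case: nA; exists x.
apply: (@classified_centered _ _ c [:: (p, c); (q, c)] [:: (w, c, p); (p, q, u)]) => //.
apply: (separated_covers (Q := fun x => x <> c)) => x a b xc h.
have := framed_off_center F xc h.
case=> [[? ?]|[[? ?]|[[? ?]|[[? ?]|[[? ?]|[[? ?]|[? ?]]]]]]]; subst; try by listed.
- by have ? := hD _ h; listed.
- by have [_ /hC] := patDE F hu h.
- by have ? := hw _ h; listed.
- by have [_ /hC] := patBD F h hu.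
- by case: (hC _ h).
Qed.

Lemma classified_framed P c p q : 5 <= #|V| -> framed P c p q ->
  classified (separated P).
Proof.
move=> V5 F; have Fc := framed_converse F.
case: (pselect (exists u u', [/\ P p q p u, P p q p u' & u <> u'])).
  by case=> u [u' [h h' n]]; exact: (classified_double_D V5 F h h').
move=> D1.
case: (pselect (exists u u', [/\ P q u q p, P q u' q p & u <> u'])).
  case=> u [u' [h h' n]]; rewrite -separated_converse.
  exact: (classified_double_D V5 Fc h h').
move=> E1.
have {}D1 u u' : P p q p u -> P p q p u' -> u = u'.
  move=> h h'; case: (eqVneq u u') => // /eqP n; by case: D1; exists u, u'.
have {}E1 u u' : P q u q p -> P q u' q p -> u = u'.
  move=> h h'; case: (eqVneq u u') => // /eqP n; by case: E1; exists u, u'.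
case: (pselect (exists w, P w q w p)) => [[w hC]|nC].
  apply: (classified_C V5 F hC) => u h.
    exact: D1 h (patCD F hC h).
  exact: E1 h (patCD Fc hC h).
have {}nC w : ~ P w q w p by move=> h; apply: nC; exists w.
case: (pselect (exists u, P p q p u)) => [[u h]|nD].
  by apply: (classified_D_noC F nC h) => v h'; exact: D1 h' h.
case: (pselect (exists u, P q u q p)) => [[u h]|nE].
  rewrite -separated_converse.
  by apply: (classified_D_noC Fc _ h) => [w|v h']; [exact: nC | exact: E1 h' h].
have uniqA P' p' q' : framed P' c p' q' -> exists w, forall x, P' x c x p' -> x = w.
  move=> F'; case: (pselect (exists w, P' w c w p')) => [[w h]|nA].
    by exists w => x h'; exact: (patA_uniq F' h' h).
  by exists c => x h; case: nA; exists x.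
have [w hw] := uniqA _ _ _ F; have [w' hw'] := uniqA _ _ _ Fc.
(* Only A and B are left, each at one vertex at most, so the weight off c is again 6. *)
apply: (@classified_centered _ _ c [:: (p, c); (q, c)] [:: (w, c, p); (w', q, c)]) => //.
apply: (separated_covers (Q := fun x => x <> c)) => x a b xc h.
have := framed_off_center F xc h.
case=> [[? ?]|[[? ?]|[[? ?]|[[? ?]|[[? ?]|[[? ?]|[? ?]]]]]]]; subst; try by listed.
- by case: nD; exists b.
- by case: nE; exists a.
- by have ? := hw _ h; listed.
- by have ? := hw' _ h; listed.
- by case: (nC _ h).
Qed.

(** The successor sets of such a relation form a chain under inclusion, so an element with the most
    successors has all of them. *)
Lemma free_rel_min (T : finType) (Q : rel T) (x0 : T) :
  (forall g h g' h', Q g h -> Q g' h' -> Q g h' || Q g' h) ->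
  exists e, forall g h, Q g h -> Q e h.
Proof.
move=> free.
have [e _ emax] := arg_maxnP (fun e : T => #|Q e|) (erefl (xpredT x0)).
exists e => g h gh; apply/negPn/negP => neh.
have : ~~ (Q e \subset Q g).
  apply/negP => sub; have : #|Q e| < #|Q g|.
    apply: proper_card; apply/properP; split=> //; by exists h.
  by rewrite ltnNge => /negP; apply; apply: emax.
case/subsetPn => h' eh' ngh'.
by have := free _ _ _ _ gh eh'; rewrite (negPf neh) orbF; apply/negP.
Qed.

(** A first and a last edge exist by [free_rel_min]. Being comparable, they share a vertex, which
    becomes c. *)
Lemma edge_order_classified P : 5 <= #|V| -> edge_order P ->
  classified (separated P).
Proof.
move=> V5 o.
have [v0 _] : exists v : V, true by case/card_gt0P: (leq_trans (ltn0Sn 4) V5) => v; exists v.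
case: (pselect (exists a b x y, P a b x y)); last first.
  move=> nP; apply: (@classified_centered _ _ v0 [::] [::]) => // x a b _.
  by case/orP=> h; case: nP; [exists x, a, x, b | exists x, b, x, a].
case=> a [b [x [y h]]].
pose Q (e f : V * V) := P e.1 e.2 f.1 f.2.
have [e he] : exists e, forall g h, Q g h -> Q e h.
  apply: (free_rel_min (a, b)) => g1 h1 g2 h2 k1 k2.
  by case: (eo_free o k1 k2) => k; apply/orP; [left | right].
have [f hf] : exists f, forall g h, Q h g -> Q h f.
  apply: (free_rel_min (Q := fun g h => Q h g) (x, y)) => g1 h1 g2 h2 k1 k2.
  by case: (eo_free o k1 k2) => k; apply/orP; [right | left].
case: e he => e1 e2 he; case: f hf => f1 f2 hf.
have ef : P e1 e2 f1 f2 by apply: (hf (x, y) (e1, e2)); apply: (he (a, b) (x, y)).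
have first a' b' x' y' : P a' b' x' y' -> P e1 e2 x' y' by apply: (he (a', b') (x', y')).
have last a' b' x' y' : P a' b' x' y' -> P a' b' f1 f2 by apply: (hf (x', y') (a', b')).
have symL := eo_symL o; have symR := eo_symR o.
case: (eo_meet o ef) => [|[|[|]]] E; subst.
- by apply: (@classified_framed _ f1 e2 f2) => //; split.
- apply: (@classified_framed _ f2 e2 f1) => //; split=> //.
  + by move=> a' b' x' y' /last; rewrite symR.
  + by rewrite symR.
- apply: (@classified_framed _ f1 e1 f2) => //; split=> //.
  + by move=> a' b' x' y' /first; rewrite symL.
  + by rewrite symL.
- apply: (@classified_framed _ f2 e1 f1) => //; split=> //.
  + by move=> a' b' x' y' /first; rewrite symL.
  + by move=> a' b' x' y' /last; rewrite symR.
  + by rewrite symR symL.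
Qed.

End Frame.

(** * Counting weights over all coordinates *)

Section Counting.

Variables (V J : finType).

Lemma sum_weight_cover (s : J -> V -> V -> bool) (k : J -> nat) (x : V) :
  (forall j, weight_cover (s j) (k j)) ->
  (forall a b, a <> x -> b <> x -> a <> b -> exists j, s j a b) ->
  2 * #|V| <= \sum_j k j + 5.
Proof.
move=> /fin_all_exists[S] /fin_all_exists[E] hSE hs.
pose US := \bigcup_j S j; pose UE := \bigcup_j E j.
have hU : 2 * #|US| + #|UE| <= \sum_j k j.
  apply: (@leq_trans (\sum_j (2 * #|S j| + #|E j|))); last first.
    by apply: leq_sum => j _; case: (hSE j).
  rewrite big_split /= -big_distrr /= leq_add ?leq_mul //.
    by rewrite /US; elim/big_rec2: _ => [|j m A _ h]; rewrite ?cards0 //;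
       apply: leq_trans (leq_card_setU _ _) _; rewrite leq_add2l.
  by rewrite /UE; elim/big_rec2: _ => [|j m A _ h]; rewrite ?cards0 //;
     apply: leq_trans (leq_card_setU _ _) _; rewrite leq_add2l.
(* No star reaches [T], so each pair inside it needs its own single cherry. *)
pose T := ~: (x |: US).
have hT : 'C(#|T|, 2) <= #|UE|.
  rewrite -cards_draws; apply: subset_leq_card; apply/subsetP => A.
  rewrite inE => /andP[/subsetP AT /cards2P[a [b [ab eA]]]].
  have [aT bT] : a \in T /\ b \in T by split; apply: AT; rewrite eA !inE eqxx ?orbT.
  move: aT bT; rewrite !inE !negb_or => /andP[/eqP ax aS] /andP[/eqP bx bS].
  have [j /(proj2 (hSE j))] := hs a b ax bx (elimN eqP ab).
  case=> h; last by rewrite eA; apply/bigcupP; exists j.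
    by case/negP: aS; apply/bigcupP; exists j.
  by case/negP: bS; apply/bigcupP; exists j.
have cT : #|V| <= #|T| + #|US| + 1.
  have := cardsC (x |: US); have := leq_of_leqif (leq_card_setU [set x] US); rewrite cards1 -/T; lia.
(* Equality holds for sizes 2 and 3. *)
have : 2 * #|T| <= 'C(#|T|, 2) + 3.
  rewrite bin2; case: #|T| => [|[|[|[|t]]]] //=.
  have : 2 * t.+1 <= (t.+4 * t.+3)./2.
    by rewrite -divn2 leq_divRL //; nia.
  rewrite -divn2; nia.
lia.
Qed.

Lemma sum_weights_ge (om : J -> V -> nat) (X : {set V}) m :
  (forall x, m <= \sum_j om j x) ->
  #|X| * m <= \sum_j \sum_(x in X) om j x.
Proof.
by move=> h; rewrite exchange_big /= -sum_nat_const; apply: leq_sum.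
Qed.

End Counting.

Lemma sum_off_center (V : finType) (om : V -> nat) (X : {set V}) c :
  c \notin X -> \sum_(x in X) om x <= \sum_(x | x != c) om x.
Proof.
move=> cX; rewrite [leqRHS](bigID (mem X)) /=.
rewrite (eq_bigl (fun x => (x != c) && (x \in X))) ?leq_addr // => x.
by case: (boolP (x \in X)) => xX; rewrite ?andbF ?andbT //; apply/esym; apply: contraNneq cX => <-.
Qed.

Lemma sum_subset (V : finType) (om : V -> nat) (X : {set V}) :
  \sum_(x in X) om x <= \sum_x om x.
Proof. by rewrite [leqRHS](bigID (mem X)) /= leq_addr. Qed.

Lemma weights_contradiction5 (V : finType) (om om' : V -> nat) :
  #|V| = 5 -> (forall x, 5 <= om x + om' x) ->
  centered om 6 \/ light om -> centered om' 6 \/ light om' -> False.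
Proof.
move=> V5 h t t'.
(* Off both centres there remain at least three vertices, each requiring weight 5. *)
have two k k' : k + k' < 15 -> centered om k -> centered om' k' -> False.
  move=> kk [c hc] [c' hc'].
  have : #|~: [set c; c']| * 5 <= \sum_(x in ~: [set c; c']) (om x + om' x).
    by rewrite -sum_nat_const; apply: leq_sum.
  rewrite big_split /=.
  have := @sum_off_center _ om (~: [set c; c']) c.
  have := @sum_off_center _ om' (~: [set c; c']) c'.
  rewrite !inE !eqxx orbT /= => /(_ erefl) h1 /(_ erefl) h2.
  have := cardsC [set c; c']; have : #|[set c; c']| <= 2 by rewrite cards2; case: eqP.
  lia.
(* Four vertices off the centre require 20, but only 13 + 6 is available. *)
have one (o1 o2 : V -> nat) : (forall x, 5 <= o1 x + o2 x) ->
    light o1 -> centered o2 6 -> False.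
  move=> h12 [s13 _ _] [c hc].
  have : #|[set~ c]| * 5 <= \sum_(x in [set~ c]) (o1 x + o2 x).
    by rewrite -sum_nat_const; apply: leq_sum.
  rewrite big_split /=.
  have := @sum_off_center _ o2 [set~ c] c; have := sum_subset o1 [set~ c].
  rewrite !inE eqxx /= => h1 /(_ erefl) h2.
  by rewrite cardsC1 V5; lia.
(* Where [o2] vanishes [o1] is at least 5, which excludes the bound 4. *)
have zero (o1 o2 : V -> nat) : (forall x, 5 <= o1 x + o2 x) ->
    light o1 -> light o2 -> centered o1 7.
  move=> h12 [_ _ [//|le4]] [_ [u u0] _].
  by have := h12 u; have := le4 u; lia.
have h' x : 5 <= om' x + om x by rewrite addnC.
case: t t' => [t|t] [t'|t'].
- exact: (two 6 6 isT t t').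
- exact: one h' t' t.
- exact: one h t t'.
- exact: (two 7 7 isT (zero _ _ h t t') (zero _ _ h' t' t)).
Qed.

Lemma weights_contradiction (V : finType) d (om : 'I_d -> V -> nat) :
  6 <= #|V| -> d + 3 = #|V| ->
  (forall x, 2 * #|V| <= \sum_j om j x + 5) ->
  (forall j, centered (om j) 6 \/ light (om j)) -> False.
Proof.
move=> V6 dV h t.
pose N j := `[< centered (om j) 6 >].
have [c hc] : exists c : 'I_d -> V, forall j, N j -> \sum_(x | x != c j) om j x <= 6.
  apply: (@fin_all_exists _ (fun=> V)
    (fun j c => N j -> \sum_(x | x != c) om j x <= 6)) => j.
  rewrite /N; case: (asboolP (centered (om j) 6)) => [[c hc]|n].
    by exists c.
  have [v _] : exists v : V, true by case/card_gt0P: (leq_trans (ltn0Sn 5) V6) => v; exists v.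
  by exists v.
(* Off all the chosen centres, each coordinate in [N] contributes at most 6. *)
pose X := ~: [set c j | j in N].
have hX : #|V| - #|N| <= #|X|.
  have h1 : #|[set c j | j in N]| <= #|N| := leq_imset_card _ _.
  have h2 : #|[set c j | j in N]| + #|X| = #|V| := cardsC _.
  by rewrite -h2 leq_subLR leq_add2r.
have low : #|X| * (2 * #|V| - 5) <= \sum_j \sum_(x in X) om j x.
  by apply: sum_weights_ge => x; have := h x; lia.
have up : \sum_j \sum_(x in X) om j x <= 6 * #|N| + 13 * #|[predC N]|.
  rewrite (bigID N) /= leq_add //.
    rewrite mulnC -sum_nat_const; apply: leq_sum => j Nj.
    apply: leq_trans (hc j Nj); apply: sum_off_center.
    by rewrite inE negbK; apply: imset_f.
  rewrite mulnC -sum_nat_const; apply: leq_sum => j nNj.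
  case: (t j) => [/asboolP Nj|[s13 _ _]]; first by rewrite /N Nj in nNj.
  exact: leq_trans (sum_subset _ _) s13.
have := cardC N; rewrite card_ord => cN.
move: low up hX cN; move: (\sum_j _) => S.
(* With |V| = k + m + 3 and at least m + 3 vertices in [X], the bounds give (m + 3)(2k + 2m + 1) <=
   6k + 13m, that is 2m(k + m - 3) + 3 <= 0. This fails since k + m >= 3. *)
move: #|X| #|N| #|[predC N]| => cX k m; nia.
Qed.

Lemma edge_orders_dont_cover (V : finType) d (P : 'I_d -> V -> V -> V -> V -> bool) :
  5 <= #|V| -> d + 3 = #|V| -> (forall j, edge_order (P j)) ->
  ~ (forall x a b, a <> x -> b <> x -> a <> b -> exists j, separated (P j) x a b).
Proof.
move=> V5 dV o cov.
have [om hom] := fin_all_exists (fun j => edge_order_classified V5 (o j)).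
have h x : 2 * #|V| <= \sum_j om j x + 5.
  apply: (sum_weight_cover (s := fun j => separated (P j) x) (x := x)) => [j|].
    by have [] := hom j.
  exact: cov.
have t j : centered (om j) 6 \/ light (om j) by have [] := hom j.
move: V5; rewrite leq_eqVlt => /orP[/eqP V5|V6]; last exact: (weights_contradiction V6 dV h t).
have d2 : d = 2 by lia.
subst d; apply: (weights_contradiction5 (esym V5) _ (t ord0) (t ord_max)) => x.
by have := h x; rewrite big_ord_recr big_ord1 /= -V5 (_ : widen_ord _ _ = ord0); [lia | apply/val_inj].
Qed.

Section BoxRepresentations.

Local Open Scope ring_scope.

(** The coordinatewise maximum of the left ends is a common point. *)
Lemma box_meetP (R : realType) d (a b a' b' : 'rV[R]_d) :
  (forall j, a 0 j <= b 0 j) -> (forall j, a' 0 j <= b' 0 j) ->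
  classical_sets.nonempty (classical_sets.setI (box a b) (box a' b')) <->
  forall j, (a 0 j <= b' 0 j) && (a' 0 j <= b 0 j).
Proof.
move=> ab ab'; split=> [[x [h h']] j|h].
  have /andP[h1 h2] := h j; have /andP[h3 h4] := h' j.
  by rewrite (le_trans h1 h4) (le_trans h3 h2).
exists (\row_j Num.max (a 0 j) (a' 0 j)); split=> j; have /andP[h1 h2] := h j;
  by rewrite !mxE le_max ge_max lexx ?ab ?ab' ?h1 ?h2 ?orbT.
Qed.

(** * Lower bound: the edge orders of a box representation *)

Section LowerBound.

Variables (R : realType) (n d : nat).
Hypothesis dn : (d <= n - 3)%N.
Variables a b : kneser n 2 -> 'rV[R]_d.
Hypothesis ab : forall v j, a v 0 j <= b v 0 j.
Hypothesis adjP : forall u v : kneser n 2, u != v -> adj u v <->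
  classical_sets.nonempty (classical_sets.setI (box (a u) (b u)) (box (a v) (b v))).

(* Trivial coordinates [0, 0] pad the representation to exactly n - 3 ones. *)
Definition coord (f : kneser n 2 -> 'rV[R]_d) (j : 'I_(n - 3)) (A : {set 'I_n}) : R :=
  if (insub A : option (kneser n 2), insub (val j) : option 'I_d) is (Some v, Some i)
  then f v 0 i else 0.

(** The interval order of coordinate [j]; the inequalities exclude [[set x; x]], which is not a
    vertex of the graph. *)
Definition coord_order j x y z t :=
  [&& x != y, z != t & coord b j [set x; y] < coord a j [set z; t]].

Lemma edge_subproof (x y : 'I_n) : x != y -> #|[set x; y]| == 2%N.
Proof. by move=> xy; rewrite cards2 xy. Qed.

Lemma coord_edge f (j : 'I_(n - 3)) x y (xy : x != y) :
  coord f j [set x; y] =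
  if insub (val j) is Some i then f (Sub [set x; y] (edge_subproof xy)) 0 i else 0.
Proof. by rewrite /coord (insubT (fun A : {set 'I_n} => #|A| == 2%N) (edge_subproof xy)). Qed.

Lemma coord_order_edge_order j : edge_order (coord_order j).
Proof.
split; rewrite /coord_order.
- by move=> x y z t /and3P[/eqP ? /eqP ? _].
- by move=> x y z t; rewrite eq_sym setUC.
- by move=> x y z t; rewrite [z == t]eq_sym (setUC [set z]).
- move=> x y; apply/negP => /and3P[xy _]; rewrite !(coord_edge _ _ xy).
  by case: insub => [i|]; rewrite ?ltxx // ltNge ab.
- move=> x y z t x' y' z' t' /and3P[-> -> h] /and3P[-> -> h'] /=.
  case: (ltP (coord b j [set x; y]) (coord a j [set z'; t'])) => k; first by left.
  by right; apply: lt_trans h' (le_lt_trans k h).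
move=> x y z t /and3P[xy zt]; rewrite (coord_edge _ _ xy) (coord_edge _ _ zt).
case: insub => [i h|]; last by rewrite ltxx.
have [dis|] := boolP [disjoint [set x; y] & [set z; t]]; last first.
  rewrite -setI_eq0 => /set0Pn[s]; rewrite !inE => /andP[].
  by do 2![case/orP=> /eqP ?; subst]; intuition.
set u : kneser n 2 := Sub _ _ in h; set v : kneser n 2 := Sub _ _ in h.
have uv : u != v.
  apply: contraTneq dis => /(congr1 val) /= ->; rewrite -setI_eq0 setIid.
  by apply/set0Pn; exists z; rewrite !inE eqxx.
(* Disjoint edges are adjacent vertices, so their intervals meet in every coordinate. *)
have /adjP-/(_ uv) : adj u v by rewrite /adj /= /kneser_adj uv.
rewrite box_meetP // => /(_ i) /andP[_].
by rewrite leNgt h.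
Qed.

(** The two edges of a cherry are nonadjacent vertices, so their disjoint boxes differ in some
    coordinate by [box_meetP]. *)
Lemma coord_order_cover (x y z : 'I_n) : y <> x -> z <> x -> y <> z ->
  exists j, separated (coord_order j) x y z.
Proof.
move=> /eqP yx /eqP zx /eqP yz; rewrite eq_sym in yx; rewrite eq_sym in zx.
pose u : kneser n 2 := Sub [set x; y] (edge_subproof yx).
pose v : kneser n 2 := Sub [set x; z] (edge_subproof zx).
have uv : u != v.
  apply/eqP => /(congr1 val) /= e.
  have : y \in [set x; z] by rewrite -e !inE eqxx orbT.
  by rewrite !inE eq_sym (negPf yx) (negPf yz).
have : ~ adj u v.
  rewrite /adj /= /kneser_adj uv /= => /pred0P/(_ x).
  by rewrite /= !inE eqxx.
rewrite adjP // box_meetP // => h.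
have : ~~ [forall i, (a u 0 i <= b v 0 i) && (a v 0 i <= b u 0 i)].
  by apply/negP => /forallP.
rewrite negb_forall => /existsP[i h']; have lt_i : (i < n - 3)%N by apply: leq_trans dn.
exists (Ordinal lt_i).
rewrite /separated /coord_order yx zx /= !(coord_edge _ _ yx) !(coord_edge _ _ zx) /= valK.
by move: h'; rewrite negb_and -!ltNge orbC.
Qed.

End LowerBound.

Lemma kneser2_not_box_representable (R : realType) n d :
  (5 <= n)%N -> (d < n - 2)%N -> ~ box_representable R (kneser n 2) d.
Proof.
move=> n5 dn [a [b [ab adjP]]].
have dn3 : (d <= n - 3)%N by lia.
apply: (@edge_orders_dont_cover 'I_n (n - 3) (coord_order a b)); rewrite ?card_ord; try lia.
  by move=> j; apply: coord_order_edge_order.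
by move=> x y z; apply: coord_order_cover.
Qed.

(** * Upper bound: a representation with n - 2 coordinates *)

Section UpperBound.

Local Open Scope nat_scope.

(* In coordinate v the edge vy is the point y, and an edge avoiding v is [0, n-1]
   shortened by one at each end that it contains as a vertex. *)
Definition lo (v x y : nat) : nat :=
  if x == v then y else if y == v then x else (x == 0) || (y == 0).

Definition hi (n v x y : nat) : nat :=
  if x == v then y else if y == v then x
  else n.-1 - ((x == n.-1) || (y == n.-1)).

Lemma loC v x y : lo v x y = lo v y x.
Proof. by rewrite /lo orbC; do 2!case: eqP => // ->. Qed.

Lemma hiC n v x y : hi n v x y = hi n v y x.
Proof. by rewrite /hi orbC; do 2!case: eqP => // ->. Qed.

Definition overlap n v x y z t := (lo v x y <= hi n v z t) && (lo v z t <= hi n v x y).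

Lemma lo_avoid y z t : y != z -> y != t -> (z == 0) || (t == 0) <= y.
Proof.
case: y => [|y] yz yt; last by case: (_ || _).
by rewrite ![_ == 0]eq_sym (negPf yz) (negPf yt).
Qed.

Lemma hi_avoid n y z t : y < n -> y != z -> y != t ->
  y <= n.-1 - ((z == n.-1) || (t == n.-1)).
Proof.
move=> yn yz yt; have [yn1|yn1] := eqVneq y n.-1.
  by rewrite -yn1 ![_ == y]eq_sym (negPf yz) (negPf yt) subn0.
have := leq_b1 ((z == n.-1) || (t == n.-1)).
by move: (nat_of_bool _) => k; lia.
Qed.

(** At most one of the edges contains v. If one does, its point is missing from the other interval
    only if it is a vertex of that edge; if none does, both intervals contain [1, n-2]. *)
Lemma overlap_disjoint n v x y z t : 5 <= n -> x < n -> y < n -> z < n -> t < n ->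
  x != z -> x != t -> y != z -> y != t -> overlap n v x y z t.
Proof.
move=> n5 xn yn zn tn xz xt yz yt; rewrite /overlap /lo /hi.
have [ex|nx] := eqVneq x v.
  by rewrite -ex ![_ == x]eq_sym (negPf xz) (negPf xt) hi_avoid ?lo_avoid.
have [ey|ny] := eqVneq y v.
  by rewrite -ey ![_ == y]eq_sym (negPf yz) (negPf yt) hi_avoid ?lo_avoid.
have [ez|nz] := eqVneq z v.
  by rewrite lo_avoid ?hi_avoid // eq_sym.
have [et|nt] := eqVneq t v.
  by rewrite lo_avoid ?hi_avoid // eq_sym.
by move: (_ || _) (_ || _) (_ || _) (_ || _) => [] [] [] []; lia.
Qed.

(** If w is not an end, coordinate w has distinct points y and t. Otherwise y or t is not an end,
    and in its coordinate one edge is the end point w, which the other edge, containing w, has cut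
    off. *)
Lemma overlap_common n w y t : 5 <= n -> w < n -> y < n -> t < n ->
  w != y -> w != t -> y != t ->
  ~ (forall v, 0 < v < n.-1 -> overlap n v w y w t).
Proof.
move=> n5 wn yn tn wy wt yt h.
have [vw|nw] := boolP (0 < w < n.-1).
  by have := h w vw; rewrite /overlap /lo /hi !eqxx; lia.
have [vy|ny] := boolP (0 < y < n.-1).
  by have := h y vy; rewrite /overlap /lo /hi !eqxx (negPf wy) eq_sym (negPf yt); lia.
have vt : 0 < t < n.-1 by lia.
by have := h t vt; rewrite /overlap /lo /hi !eqxx (negPf wt) (negPf yt); lia.
Qed.

End UpperBound.

Lemma kneser2_box_representable (R : realType) n :
  (5 <= n)%N -> box_representable R (kneser n 2) (n - 2).
Proof.
move=> n5.
have [f hf] : exists f : kneser n 2 -> 'I_n * 'I_n,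
    forall v, (f v).1 != (f v).2 /\ val v = [set (f v).1; (f v).2].
  apply: (@fin_all_exists _ (fun=> ('I_n * 'I_n)%type)
    (fun v f => f.1 != f.2 /\ val v = [set f.1; f.2])) => v.
  by have /cards2P[x [y xy]] := valP v; exists (x, y).
(* The shift lets [j.+1] run over 1, ..., n-2, so the two fixed vertices are 0 and n-1. *)
exists (fun v => \row_j (lo j.+1 (f v).1 (f v).2)%:R).
exists (fun v => \row_j (hi n j.+1 (f v).1 (f v).2)%:R).
have le v (j : 'I_(n - 2)) : (lo j.+1 (f v).1 (f v).2 <= hi n j.+1 (f v).1 (f v).2)%N.
  by rewrite /lo /hi; case: eqP => // _; case: eqP => // _; lia.
split=> [v j|u v uv]; first by rewrite !mxE ler_nat.
rewrite box_meetP => [|j|j]; rewrite ?mxE ?ler_nat //.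
rewrite /adj /= /kneser_adj uv /=.
have : val u != val v by [].
have [] := hf u; have [] := hf v.
case: (f u) (f v) => [x y] [z t] /= zt -> xy -> ne.
have sets : [disjoint [set x; y] & [set z; t]] <->
    [&& x != z, x != t, y != z & y != t].
  rewrite disjoints_subset subUset !sub1set !inE !negb_or.
  by rewrite -andbA.
rewrite sets; split=> [/and4P[xz xt yz yt] j|h].
  rewrite !mxE !ler_nat; by apply: overlap_disjoint.
have {}h w : (0 < w < n.-1)%N -> overlap n w x y z t.
  case: w => // w wn; have wn2 : (w < n - 2)%N by lia.
  by have := h (Ordinal wn2); rewrite !mxE !ler_nat.
(* Each of the four possible common vertices is brought to the front by symmetry and refuted by
   [overlap_common]. *)
apply/and4P; split; apply/eqP => e; subst.
- apply: (@overlap_common n z y t) h => //.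
  by apply: contraNneq ne => /val_inj ->.
- have {}h w : (0 < w < n.-1)%N -> overlap n w t y t z.
    by move=> /h; rewrite /overlap (loC _ z) (hiC _ _ z).
  apply: overlap_common h => //; first by rewrite eq_sym.
  by apply: contraNneq ne => /val_inj ->; rewrite setUC.
- have {}h w : (0 < w < n.-1)%N -> overlap n w z x z t.
    by move=> /h; rewrite /overlap (loC _ x) (hiC _ _ x).
  apply: overlap_common h => //; first by rewrite eq_sym.
  by apply: contraNneq ne => /val_inj ->; rewrite setUC.
- have {}h w : (0 < w < n.-1)%N -> overlap n w t x t z.
    by move=> /h; rewrite /overlap (loC _ x) (hiC _ _ x) (loC _ z) (hiC _ _ z).
  apply: overlap_common h; rewrite // 1?eq_sym //.
  by apply: contraNneq ne => /val_inj ->.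
Qed.

End BoxRepresentations.

Theorem theorem1 (R : realType) :
  (forall n : nat, 5 <= n -> boxicity R (kneser n 2) = n - 2) /\
  boxicity R (kneser 5 2) = 3.
Proof.
have box n : 5 <= n -> boxicity R (kneser n 2) = n - 2.
  move=> n5; rewrite /boxicity; case: ex_minnP => m /asboolP rm min.
  apply/eqP; rewrite eqn_leq min; last by apply/asboolP; exact: kneser2_box_representable.
  by rewrite leqNgt; apply/negP => /(kneser2_not_box_representable n5)/(_ rm).
by split; [exact: box | exact: box].
Qed.
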